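(* Let $\omega^{\omega^{\alpha}}$ be a principal ordinal. The commutative semiring $W(\omega^{\omega^\alpha})=\{x:x<\omega^{\omega^\alpha}\}$ under the Hessenberg natural sum and product is isomorphic to the free commutative semiring $\mathbb{N}_0^{(\coprod_\alpha\mathbb{N}_0)}$ in the category of commutative semirings with unit.
   Context: $\mathbb{N}_0$ is the set of natural numbers including $0$. $\coprod_\alpha\mathbb{N}_0$ is the coproduct (direct sum) of copies of the additive monoid $\mathbb{N}_0$ indexed by the ordinal $\alpha$ (that is, by the set $\{x:x<\alpha\}$), i.e. the free commutative monoid on $\alpha$ generators. $\mathbb{N}_0^{(\coprod_\alpha\mathbb{N}_0)}$ is the semigroup semiring with coefficients in $\mathbb{N}_0$ of this monoid written multiplicatively (finite formal $\mathbb{N}_0$-combinations of monoid elements), i.e. the polynomial semiring over $\mathbb{N}_0$ in $\alpha$ many indeterminates, the free commutative semiring with unit on $\alpha$ generators. Hessenberg operations: if $x=\sum_i\omega^{\xi_i}p_i$, $y=\sum_i\omega^{\xi_i}q_i$ are Cantor normal forms (padded with zero coefficients to a common set of exponents), the natural sum is $\sum_i\omega^{\xi_i}(p_i+q_i)$; the natural product is obtained by distributivity and associativity from $\omega^{\xi}\cdot\omega^{\eta}=\omega^{\xi(+)\eta}$, where $(+)$ is the natural sum. *)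

(* Defs.v *)
From HB Require Import structures.
From mathcomp Require Import all_boot all_order all_algebra finmap.
From mathcomp Require Import generic_quotient.
From mathcomp Require Import boolp classical_sets.
From mathcomp.multinomials Require Import monalg.

Set Implicit Arguments.
Unset Strict Implicit.
Unset Printing Implicit Defensive.

Import Order.TTheory GRing.Theory.

(** [Lub f] presents the least ordinal strictly above all the [f a]; every
    ordinal arises in this way from the family of its predecessors.  The type
    [Ord] is the quotient of these presentations by equality of the ordinals
    they denote; its elements are the order types of the well-orders living in
    a fixed universe ([Ord_wf], [Ord_order_type]). *)

Inductive tree : Type := Lub (A : Type) (f : A -> tree).

Definition idx (t : tree) : Type := match t return Type with Lub A _ => A end.
Definition branch (t : tree) : idx t -> tree :=
  match t return idx t -> tree with Lub _ f => f end.

Fixpoint tle (s t : tree) {struct s} : Prop :=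
  let: Lub A f := s in
  let: Lub B g := t in
  forall a : A, exists b : B, tle (f a) (g b).

Definition tlt (s t : tree) : Prop := exists b : idx t, tle s (branch b).

Lemma tleP s t : tle s t <-> forall a : idx s, tlt (branch a) t.
Proof. by case: s t => [A f] [B g]. Qed.

Lemma tle_refl s : tle s s.
Proof. by elim: s => A f IH a; exists a; apply: IH. Qed.

Lemma tle_trans t s u : tle s t -> tle t u -> tle s u.
Proof.
elim: s t u => A f IH [B g] [C h] st tu a.
have [b fg] := st a; have [c gh] := tu b; exists c; exact: IH fg gh.
Qed.

Lemma tle_lt_trans t s u : tle s t -> tlt t u -> tlt s u.
Proof. by move=> st [c tc]; exists c; apply: tle_trans tc. Qed.

Lemma tlt_le_trans t s u : tlt s t -> tle t u -> tlt s u.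
Proof. by move=> [b sb] /tleP/(_ b); apply: tle_lt_trans. Qed.

Lemma tlt_irr s : ~ tlt s s.
Proof. by elim: s => A f IH [a /tleP/(_ a)]; apply: IH. Qed.

Lemma tle_or_gt s t : tle s t \/ tlt t s.
Proof.
elim: s t => A f IH t.
have [fle|] := pselect (forall a, tlt (f a) t); first by left; apply/tleP.
move=> /existsNP[a nfa]; right; exists a; apply/tleP => b.
by have [fb|//] := IH a (branch b); case: nfa; exists b.
Qed.

Lemma tltNle s t : tlt s t <-> ~ tle t s.
Proof.
split=> [st ts|nts]; first exact: (tlt_irr (tlt_le_trans st ts)).
by have [//|] := tle_or_gt t s.
Qed.

Lemma branch_le t (b : idx t) : tle (branch b) t.
Proof.
elim: t b => A f IH a; apply/tleP => b; exists a; exact: IH.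
Qed.

Lemma tltW s t : tlt s t -> tle s t.
Proof. by move=> [b sb]; apply: tle_trans sb (branch_le b). Qed.

Definition teq (s t : tree) : bool := `[< tle s t /\ tle t s >].

Lemma teq_refl : reflexive teq.
Proof. by move=> s; apply/asboolP; split; apply: tle_refl. Qed.

Lemma teq_sym : symmetric teq.
Proof. by move=> s t; apply/asboolP/asboolP => -[]. Qed.

Lemma teq_trans : transitive teq.
Proof.
move=> t s u /asboolP[st ts] /asboolP[tu ut].
by apply/asboolP; split; apply: tle_trans; eassumption.
Qed.

Canonical teq_equiv := EquivRel teq teq_refl teq_sym teq_trans.

HB.instance Definition _ := gen_eqMixin tree.
HB.instance Definition _ := gen_choiceMixin tree.

Local Open Scope quotient_scope.

Definition Ord := {eq_quot teq}.
HB.instance Definition _ := Choice.on Ord.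
HB.instance Definition _ := EqQuotient.on Ord.

Definition ole (x y : Ord) : bool := `[< tle (repr x) (repr y) >].

Lemma ole_refl : reflexive ole.
Proof. by move=> x; apply/asboolP/tle_refl. Qed.

Lemma ole_anti : antisymmetric ole.
Proof.
move=> x y /andP[/asboolP xy /asboolP yx].
by rewrite -[x]reprK -[y]reprK; apply/eqmodP/asboolP.
Qed.

Lemma ole_trans : transitive ole.
Proof.
by move=> y x z /asboolP xy /asboolP yz; apply/asboolP/(tle_trans xy).
Qed.

Fact Ord_display : Order.disp_t. Proof. exact: (Order.Disp tt tt). Qed.

HB.instance Definition _ :=
  Order.Le_isPOrder.Build Ord_display Ord ole_refl ole_anti ole_trans.

Local Open Scope order_scope.

Lemma ole_total : total (<=%O : rel Ord).
Proof.
by move=> x y; have [xy|/tltW yx] := tle_or_gt (repr x) (repr y);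
  apply/orP; [left|right]; apply/asboolP.
Qed.

HB.instance Definition _ :=
  Order.POrder_isTotal.Build Ord_display Ord ole_total.

Lemma repr_pi (t : tree) : tle (repr (\pi_Ord t)) t /\ tle t (repr (\pi_Ord t)).
Proof.
have /eqmodP/asboolP[? ?] : t = repr (\pi_Ord t) %[mod Ord] by rewrite reprK.
by [].
Qed.

Lemma le_pi (s t : tree) : (\pi_Ord s <= \pi_Ord t) <-> tle s t.
Proof.
have [s1 s2] := repr_pi s; have [t1 t2] := repr_pi t.
split=> [/asboolP st|st]; last apply/asboolP.
  exact: tle_trans s2 (tle_trans st t1).
exact: tle_trans s1 (tle_trans st t2).
Qed.

Lemma lt_pi (s t : tree) : (\pi_Ord s < \pi_Ord t) <-> tlt s t.
Proof.
by rewrite ltNge tltNle -le_pi; split=> [/negP|/negP].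
Qed.

Lemma lt_Lub z (A : Type) (f : A -> tree) :
  (z < \pi_Ord (Lub f)) <-> exists a, z <= \pi_Ord (f a).
Proof.
rewrite -[z]reprK lt_pi; split=> -[a za]; exists a; first exact/le_pi.
by move/le_pi: za.
Qed.

Lemma Ord_wf : well_founded (fun x y : Ord => x < y).
Proof.
suff acc t s : tle s t -> Acc (fun x y : Ord => x < y) (\pi_Ord s).
  by move=> x; rewrite -[x]reprK; apply: acc (tle_refl _).
elim: t s => A f IH s st; constructor => y; rewrite -[y]reprK lt_pi => ys.
by have [a ya] := tlt_le_trans ys st; apply: IH ya.
Qed.

Lemma Ord_order_type (A : Type) (R : A -> A -> Prop) :
    well_founded R -> (forall a b c, R a b -> R b c -> R a c) ->
    (forall a b, [\/ R a b, a = b | R b a]) ->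
  exists (alpha : Ord) (f : A -> {x : Ord | x < alpha}),
    bijective f /\ forall a b, R a b <-> sval (f a) < sval (f b).
Proof.
move=> Rwf Rtr Rtot.
pose step a (rec : forall b, R b a -> tree) :=
  Lub (fun p : {b | R b a} => rec (sval p) (svalP p)).
pose rk := Fix Rwf (fun=> tree) step.
have rkE a : rk a = Lub (fun p : {b | R b a} => rk (sval p)).
  rewrite {1}/rk Fix_eq // => b f g fg; rewrite /step; congr Lub.
  by apply/funext => p; apply: fg.
have rk_lt a b : R a b -> \pi_Ord (rk a) < \pi_Ord (rk b).
  by move=> ab; rewrite (rkE b) lt_Lub; exists (exist _ a ab).
have rkP a b : R a b <-> \pi_Ord (rk a) < \pi_Ord (rk b).
  split=> [/rk_lt//|]; have [//|->|/rk_lt ba ab] := Rtot a b; first by rewrite ltxx.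
  by have := lt_trans ba ab; rewrite ltxx.
have rk_inj a b : \pi_Ord (rk a) = \pi_Ord (rk b) -> a = b.
  by move=> e; have [/rk_lt|//|/rk_lt] := Rtot a b; rewrite e ltxx.
have below a : \pi_Ord (rk a) < \pi_Ord (Lub rk) by rewrite lt_Lub; exists a.
pose f a : {x | x < \pi_Ord (Lub rk)} :=
  exist (fun x : Ord => x < \pi_Ord (Lub rk)) _ (below a).
exists (\pi_Ord (Lub rk)), f; split; last first.
  by move=> a b; rewrite rkP.
have rk_surj (z : Ord) : z < \pi_Ord (Lub rk) -> exists a, \pi_Ord (rk a) = z.
  move=> /lt_Lub[a]; elim/(well_founded_ind Rwf): a => a IH.
  rewrite le_eqVlt => /orP[/eqP->|]; first by exists a.
  by rewrite (rkE a) lt_Lub => -[[b ba]]; apply: IH.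
have [g gP] := choice (fun u : {x | x < \pi_Ord (Lub rk)} =>
  rk_surj _ (svalP u)).
exists g => [a|u]; last exact/val_inj/gP.
exact/rk_inj/(gP (f a)).
Qed.

(** The presentations below spell out the usual transfinite recursions; the
    lemmas [lt_oadd], [lt_omul] and [lt_opow] state these recursions directly
    on ordinals. *)

Definition tzero : tree := Lub (fun v : void => match v with end).
Definition tsucc (t : tree) : tree := Lub (fun _ : unit => t).
Definition tomega : tree := Lub (fun n : nat => iter n tsucc tzero).

Definition tsup (A : Type) (f : A -> tree) : tree :=
  Lub (fun p : {a : A & idx (f a)} => branch (projT2 p)).

Fixpoint tadd (s t : tree) {struct t} : tree :=
  let: Lub B g := t in
  Lub (fun k : idx s + B =>
         match k with inl a => branch a | inr b => tadd s (g b) end).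

Fixpoint tmul (s t : tree) {struct t} : tree :=
  let: Lub B g := t in
  tsup (fun b : B => tadd (tmul s (g b)) s).

(* The power omega^t. *)
Fixpoint tpow (t : tree) : tree :=
  let: Lub B g := t in
  tsup (fun o : option B =>
          if o is Some b then tmul (tpow (g b)) tomega else tsucc tzero).

Definition ozero : Ord := \pi_Ord tzero.
Definition osucc (x : Ord) : Ord := \pi_Ord (tsucc (repr x)).
Definition omega : Ord := \pi_Ord tomega.
Definition oadd (x y : Ord) : Ord := \pi_Ord (tadd (repr x) (repr y)).
Definition omul (x y : Ord) : Ord := \pi_Ord (tmul (repr x) (repr y)).
Definition opow (x : Ord) : Ord := \pi_Ord (tpow (repr x)).
Definition onat (n : nat) : Ord := iter n osucc ozero.

Lemma tadd_le s s' t t' : tle s s' -> tle t t' -> tle (tadd s t) (tadd s' t').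
Proof.
move=> ss; elim: t t' => B g IH [C h] gh; apply/tleP => -[a|b] /=.
  by have [c ac] := (tleP _ _).1 ss a; exists (inl c).
by have [c bc] := gh b; exists (inr c); apply: IH.
Qed.

Lemma tsup_le A B (f : A -> tree) (g : B -> tree) :
  (forall a, exists b, tle (f a) (g b)) -> tle (tsup f) (tsup g).
Proof.
move=> fg; apply/tleP => -[a i] /=; have [b ab] := fg a.
by have [j ij] := (tleP _ _).1 ab i; exists (existT _ b j).
Qed.

Lemma tsup_lt A (f : A -> tree) z : tlt z (tsup f) <-> exists a, tlt z (f a).
Proof.
split=> [[[a i] za]|[a [i za]]]; first by exists a, i.
by exists (existT _ a i).
Qed.
Lemma tmul_le s s' t t' : tle s s' -> tle t t' -> tle (tmul s t) (tmul s' t').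
Proof.
move=> ss; elim: t t' => B g IH [C h] gh; apply: tsup_le => b.
by have [c bc] := gh b; exists c; apply: tadd_le => //; apply: IH.
Qed.

Lemma tpow_le s t : tle s t -> tle (tpow s) (tpow t).
Proof.
elim: s t => B g IH [C h] gh; apply: tsup_le => -[b|]; last first.
  by exists None; apply: tle_refl.
have [c bc] := gh b; exists (Some c); apply: tmul_le (tle_refl _).
exact: IH.
Qed.

Lemma oaddE s t : oadd (\pi_Ord s) (\pi_Ord t) = \pi_Ord (tadd s t).
Proof.
have [s1 s2] := repr_pi s; have [t1 t2] := repr_pi t.
by apply/eqmodP/asboolP; split; apply: tadd_le.
Qed.

Lemma omulE s t : omul (\pi_Ord s) (\pi_Ord t) = \pi_Ord (tmul s t).
Proof.
have [s1 s2] := repr_pi s; have [t1 t2] := repr_pi t.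
by apply/eqmodP/asboolP; split; apply: tmul_le.
Qed.

Lemma opowE t : opow (\pi_Ord t) = \pi_Ord (tpow t).
Proof.
by have [t1 t2] := repr_pi t; apply/eqmodP/asboolP; split; apply: tpow_le.
Qed.

Lemma osuccE t : osucc (\pi_Ord t) = \pi_Ord (tsucc t).
Proof.
have [t1 t2] := repr_pi t.
by apply/eqmodP/asboolP; split; apply/tleP => -[]; exists tt.
Qed.

Lemma onatE n : onat n = \pi_Ord (iter n tsucc tzero).
Proof. by elim: n => //= n; rewrite /onat /= => ->; rewrite osuccE. Qed.


Lemma lt_ozero z : (z < ozero) = false.
Proof. by apply/negP => /lt_Lub[]. Qed.

Lemma lt_osucc z x : (z < osucc x) = (z <= x).
Proof.
apply/idP/idP => [/lt_Lub[_]|zx]; first by rewrite reprK.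
by apply/lt_Lub; exists tt; rewrite reprK.
Qed.

Lemma lt_omega z : z < omega <-> exists n, z = onat n.
Proof.
split=> [/lt_Lub[n]|[n ->]]; last first.
  by apply/lt_Lub; exists n; rewrite onatE.
rewrite -onatE; elim: n => [|n IH]; rewrite le_eqVlt => /orP[/eqP->|].
- by exists 0%N.
- by rewrite lt_ozero.
- by exists n.+1.
- by rewrite lt_osucc; apply: IH.
Qed.

Lemma lt_repr z t : z < \pi_Ord t <-> exists i : idx t, z <= \pi_Ord (branch i).
Proof. by case: t => A f; apply: lt_Lub. Qed.

Lemma lt_branch t (i : idx t) : \pi_Ord (branch i) < \pi_Ord t.
Proof. by apply/lt_repr; exists i. Qed.

Lemma oadd_le x x' y y' : x <= x' -> y <= y' -> oadd x y <= oadd x' y'.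
Proof. by move=> /asboolP ? /asboolP ?; apply/le_pi/tadd_le. Qed.

Lemma omul_le x x' y y' : x <= x' -> y <= y' -> omul x y <= omul x' y'.
Proof. by move=> /asboolP ? /asboolP ?; apply/le_pi/tmul_le. Qed.

Lemma opow_le x y : x <= y -> opow x <= opow y.
Proof. by move=> /asboolP ?; apply/le_pi/tpow_le. Qed.

Lemma lt_oadd z x y :
  z < oadd x y <-> z < x \/ exists2 y', y' < y & z <= oadd x y'.
Proof.
elim/quotW: x => s; elim/quotW: y => -[B g]; rewrite oaddE lt_repr /=.
split=> [[[a|b]]|[/lt_repr[a za]|[y' /lt_Lub[b yb] zy]]].
- by move=> za; left; apply/lt_repr; exists a.
- by move=> zb; right; exists (\pi_Ord (g b)); rewrite ?oaddE //; apply/lt_branch.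
- by exists (inl a).
- by exists (inr b); rewrite -oaddE (le_trans zy) ?oadd_le.
Qed.

Lemma lt_omul z x y :
  z < omul x y <-> exists2 y', y' < y & z < oadd (omul x y') x.
Proof.
elim/quotW: z => u; elim/quotW: x => s; elim/quotW: y => -[B g].
rewrite omulE lt_pi [tmul _ _]/= tsup_lt.
split=> [[b /lt_pi]|[y' /lt_Lub[b yb] uy]].
  by exists (\pi_Ord (g b)); [apply: (@lt_branch (Lub g))|rewrite omulE oaddE].
exists b; apply/lt_pi; rewrite /= -oaddE -omulE.
by rewrite (lt_le_trans uy) // oadd_le ?omul_le.
Qed.

Lemma lt_opow z y :
  z < opow y <->
  z < onat 1 \/ exists2 y', y' < y & z < omul (opow y') omega.
Proof.
elim/quotW: z => u; elim/quotW: y => -[B g].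
rewrite opowE lt_pi [tpow _]/= tsup_lt onatE.
split=> [[[b|] /lt_pi]|[/lt_pi|[y' /lt_Lub[b yb] uy]]].
- right; exists (\pi_Ord (g b)); first exact: (@lt_branch (Lub g)).
  by rewrite opowE omulE.
- by left.
- by exists None.
- exists (Some b); apply/lt_pi.
  rewrite -[\pi_Ord _ in X in _ < X]/(\pi_Ord (tmul (tpow (g b)) tomega)).
  rewrite -omulE -opowE.
  by rewrite (lt_le_trans uy) // omul_le ?opow_le.
Qed.

(* [cnf E p] is the sum of the omega^xi * p(xi) over the exponents xi listed in
   [E]; zero coefficients are allowed, so that two normal forms can be written
   over a common list of exponents. *)
Definition cnf (E : seq Ord) (p : Ord -> nat) : Ord :=
  \big[oadd/ozero]_(xi <- E) omul (opow xi) (onat (p xi)).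

Definition is_hsum (x y z : Ord) : Prop :=
  exists (E : seq Ord) (p q : Ord -> nat),
    [/\ sorted >%O E, x = cnf E p, y = cnf E q &
        z = cnf E (fun xi => (p xi + q xi)%N)].

(* By existence and uniqueness of Cantor normal forms exactly one [z] satisfies
   [is_hsum x y z], so that the default value of [xget] is never used; the same
   holds for [hprod]. *)
Definition hsum (x y : Ord) : Ord := xget ozero [set z | is_hsum x y z].

(* The product of two normal forms expanded by distributivity, with
   omega^xi * omega^eta = omega^(hsum xi eta). *)
Definition is_hprod (x y z : Ord) : Prop :=
  exists (E F : seq Ord) (p q : Ord -> nat),
    [/\ sorted >%O E, sorted >%O F, x = cnf E p, y = cnf F q &
        z = \big[hsum/ozero]_(xi <- E) \big[hsum/ozero]_(eta <- F)
              omul (opow (hsum xi eta)) (onat (p xi * q eta))].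

Definition hprod (x y : Ord) : Ord := xget ozero [set z | is_hprod x y z].

Definition W (beta : Ord) : Type := {x : Ord | x < beta}.
HB.instance Definition _ beta := Choice.on (W beta).

Local Open Scope ring_scope.

(* The commutative semiring structure [c] on {x : x < beta} has the Hessenberg
   sum and product as operations; in particular {x : x < beta} is closed under
   them. *)
Definition hessenberg_semiring (beta : Ord)
    (c : GRing.ComNzSemiRing.axioms_ (W beta)) : Prop :=
  let S : comNzSemiRingType := GRing.ComNzSemiRing.Pack c in
  [/\ sval (0 : S) = ozero, sval (1 : S) = onat 1,
      forall x y : S, sval (x + y) = hsum (sval x) (sval y) &
      forall x y : S, sval (x * y) = hprod (sval x) (sval y)].

(* The semigroup semiring of finite formal combinations of elements of [M] with
   coefficients in [nat]; [{malg R[M]}] would require a ring of coefficients. *)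
Definition natalg (M : conomType) : Type := {fsfun M -> nat with 0%N}.
HB.instance Definition _ M := Choice.on (natalg M).

Section NatAlg.
Variable M : conomType.
Implicit Types g h : natalg M.

Definition na0 : natalg M := [fsfun].
Definition na1 : natalg M := [fsfun k in [fset (mone : M)]%fset => 1%N].
Definition naadd g h : natalg M :=
  [fsfun k in (finsupp g `|` finsupp h)%fset => (g k + h k)%N].
Definition namul g h : natalg M :=
  [fsfun k in [fset mmul k1 k2 | k1 in finsupp g, k2 in finsupp h]%fset =>
     (\sum_(k1 <- finsupp g) \sum_(k2 <- finsupp h | mmul k1 k2 == k)
        g k1 * h k2)%N].

Lemma na0E k : na0 k = 0%N.
Proof. by rewrite fsfun0E. Qed.

Lemma na1E k : na1 k = (k == mone).
Proof. by rewrite fsfun_fun inE; case: eqP. Qed.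

Lemma naaddE g h k : naadd g h k = (g k + h k)%N.
Proof.
by rewrite fsfun_fun in_fsetU; case: (finsuppP g); case: (finsuppP h).
Qed.

Lemma namulE g h k : namul g h k =
  (\sum_(k1 <- finsupp g) \sum_(k2 <- finsupp h | mmul k1 k2 == k)
     g k1 * h k2)%N.
Proof.
rewrite fsfun_fun; case: ifPn => // kNgh.
rewrite big_seq big1 // => k1 k1g; rewrite big_seq_cond big1 // => k2.
case/andP=> k2h /eqP kE; case/negP: kNgh; apply/imfset2P.
by exists k1; rewrite ?inE //; exists k2; rewrite ?inE.
Qed.

(* The semiring laws are inherited from the monoid ring over the integers. *)
Definition toZ g : {malg int[M]} := [malg k in finsupp g => (g k)%:Z].

Lemma toZE g k : (toZ g)@_k = (g k)%:Z.
Proof. by rewrite mcoeffE; case: finsuppP. Qed.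

Lemma toZ_inj : injective toZ.
Proof.
move=> g h gh; apply/fsfunP => k.
by have := toZE g k; rewrite gh toZE => -[].
Qed.

Lemma toZ0 : toZ na0 = 0.
Proof. by apply/malgP => k; rewrite toZE na0E mcoeff0. Qed.

Lemma toZ1 : toZ na1 = 1.
Proof. by apply/malgP => k; rewrite toZE na1E mcoeff1; case: eqP. Qed.

Lemma toZD g h : toZ (naadd g h) = toZ g + toZ h.
Proof. by apply/malgP => k; rewrite mcoeffD !toZE naaddE PoszD. Qed.

Lemma msupp_toZ g : msupp (toZ g) = finsupp g.
Proof.
by apply/fsetP => k; rewrite -mcoeff_neq0 toZE mem_finsupp.
Qed.

Lemma toZM g h : toZ (namul g h) = toZ g * toZ h.
Proof.
apply/malgP => k; rewrite mcoeffMl !msupp_toZ toZE namulE.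
rewrite -[LHS]natz natr_sum; apply: eq_bigr => k1 _.
rewrite natr_sum big_mkcond; apply: eq_bigr => k2 _.
by rewrite !toZE -PoszM natz; case: ifP => _; rewrite ?mulr1n ?mulr0n.
Qed.

Let toZ_rw := (toZ0, toZ1, toZD, toZM).

Lemma naaddA : associative naadd.
Proof. by move=> x y z; apply: toZ_inj; rewrite !toZ_rw addrA. Qed.
Lemma naaddC : commutative naadd.
Proof. by move=> x y; apply: toZ_inj; rewrite !toZ_rw addrC. Qed.
Lemma naadd0 : left_id na0 naadd.
Proof. by move=> x; apply: toZ_inj; rewrite !toZ_rw add0r. Qed.
Lemma namulA : associative namul.
Proof. by move=> x y z; apply: toZ_inj; rewrite !toZ_rw mulrA. Qed.
Lemma namulC : commutative namul.
Proof. by move=> x y; apply: toZ_inj; rewrite !toZ_rw mulrC. Qed.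
Lemma namul1 : left_id na1 namul.
Proof. by move=> x; apply: toZ_inj; rewrite !toZ_rw mul1r. Qed.
Lemma namulDl : left_distributive namul naadd.
Proof. by move=> x y z; apply: toZ_inj; rewrite !toZ_rw mulrDl. Qed.
Lemma namul0 : left_zero na0 namul.
Proof. by move=> x; apply: toZ_inj; rewrite !toZ_rw mul0r. Qed.
Lemma na1_neq0 : na1 != na0.
Proof. by apply/eqP => /(congr1 toZ); rewrite !toZ_rw => /eqP; rewrite oner_eq0. Qed.

HB.instance Definition _ :=
  GRing.isNmodule.Build (natalg M) naaddA naaddC naadd0.
HB.instance Definition _ :=
  GRing.Nmodule_isComNzSemiRing.Build (natalg M)
    namulA namulC namul1 namulDl namul0 na1_neq0.

End NatAlg.

(* Main.v *)
(** Taking the coefficients of the Cantor normal form is a bijection from the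
    ordinals below omega^gamma onto the finitely supported functions
    {x : x < gamma} -> nat, and turns the natural sum into the pointwise sum.
    For gamma = alpha it identifies the ordinals below omega^alpha, under the
    natural sum, with the free commutative monoid on alpha.  For
    gamma = omega^alpha it then identifies the ordinals below
    omega^(omega^alpha) with the finitely supported functions on that monoid,
    and the natural product, which multiplies powers of omega by adding
    exponents naturally, becomes the convolution product. *)

Require Import Defs.
From HB Require Import structures.
From mathcomp Require Import all_boot all_order all_algebra finmap.
From mathcomp Require Import boolp classical_sets.
From mathcomp.multinomials Require Import monalg.

Set Implicit Arguments.
Unset Strict Implicit.
Unset Printing Implicit Defensive.

Import Order.TTheory GRing.Theory.
Local Open Scope order_scope.

(** * Ordinal sums, products and powers of [omega] *)

Lemma Ord_ext (x y : Ord) : (forall z, z < x <-> z < y) -> x = y.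
Proof.
move=> xy; apply/le_anti; rewrite !leNgt; apply/andP; split; apply/negP.
  by move/xy; rewrite ltxx.
by move/xy; rewrite ltxx.
Qed.

Lemma Ord_ind (P : Ord -> Prop) :
  (forall x, (forall y, y < x -> P y) -> P x) -> forall x, P x.
Proof. by move=> IH; apply: (well_founded_ind Ord_wf). Qed.

Lemma ozero_le x : ozero <= x.
Proof. by rewrite leNgt lt_ozero. Qed.

Lemma le_ozero x : (x <= ozero) = (x == ozero).
Proof. by rewrite eq_le ozero_le andbT. Qed.

Lemma oaddr0 x : oadd x ozero = x.
Proof.
apply: Ord_ext => z; rewrite lt_oadd; split=> [[//|[y]]|]; last by left.
by rewrite lt_ozero.
Qed.

Lemma oadd0r x : oadd ozero x = x.
Proof.
elim/Ord_ind: x => x IH; apply: Ord_ext => z; rewrite lt_oadd lt_ozero.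
split=> [[//|[y yx]]|zx]; first by rewrite IH // => /le_lt_trans; apply.
by right; exists z; rewrite ?IH.
Qed.

Lemma lt_oadd2l a x y : x < y -> oadd a x < oadd a y.
Proof. by move=> xy; rewrite lt_oadd; right; exists x. Qed.

Lemma oadd_inj a : injective (oadd a).
Proof.
by move=> x y e; case: (ltgtP x y) => // /(lt_oadd2l a); rewrite e ltxx.
Qed.

Lemma ole_addr x y : x <= oadd x y.
Proof. by rewrite -{1}[x]oaddr0 oadd_le ?ozero_le. Qed.

(** Sharpens [lt_oadd]: descending on [y] turns the bound into an exact remainder, that is, left
    subtraction of [x]. *)
Lemma lt_oaddP x y z : z < oadd x y -> z < x \/ exists2 r, r < y & z = oadd x r.
Proof.
elim/Ord_ind: y z => y IH z; rewrite lt_oadd => -[|[r ry]]; first by left.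
rewrite le_eqVlt => /orP[/eqP->|/(IH r ry)[|[s sr ->]]]; [|by left|].
  by right; exists r.
by right; exists s => //; apply: lt_trans ry.
Qed.

Lemma omulr0 x : omul x ozero = ozero.
Proof.
apply: Ord_ext => z; rewrite lt_omul lt_ozero.
by split=> // -[y]; rewrite lt_ozero.
Qed.

Lemma omulrS x y : omul x (osucc y) = oadd (omul x y) x.
Proof.
apply: Ord_ext => z; rewrite lt_omul; split=> [[y']|zxy].
  by rewrite lt_osucc => y'y /lt_le_trans; apply; rewrite oadd_le ?omul_le.
by exists y; rewrite ?lt_osucc.
Qed.

Lemma onat_le m n : (m <= n)%N -> onat m <= onat n.
Proof.
elim: n => [|n IH]; first by rewrite leqn0 => /eqP->.
rewrite leq_eqVlt ltnS => /orP[/eqP->//|/IH mn].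
by apply: (le_trans mn); rewrite ltW // lt_osucc.
Qed.

(** The left side lies below omega^x * (n+1), hence below omega^x * omega, which omega^g dominates
    because x < g. *)
Lemma lt_opowM x g n r : x < g -> r < opow x ->
  oadd (omul (opow x) (onat n)) r < opow g.
Proof.
move=> xg rx; apply/lt_opow; right; exists x => //; apply/lt_omul.
by exists (onat n); [apply/lt_omega; exists n|apply: lt_oadd2l].
Qed.

Lemma opow_gt0 x : ozero < opow x.
Proof. by apply/lt_opow; left; rewrite lt_osucc. Qed.

Lemma opow_lt x y : x < y -> opow x < opow y.
Proof.
move=> xy; have := lt_opowM 1 xy (opow_gt0 x).
by rewrite oaddr0 [onat 1]/(osucc ozero) omulrS omulr0 oadd0r.
Qed.

Lemma ole_opow x : x <= opow x.
Proof.
elim/Ord_ind: x => x IH; rewrite leNgt; apply/negP => xx.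
by have := le_lt_trans (IH _ xx) (opow_lt xx); rewrite ltxx.
Qed.

Lemma opow0 : opow ozero = onat 1.
Proof.
apply: Ord_ext => z; rewrite lt_opow; split=> [[//|[y]]|]; last by left.
by rewrite lt_ozero.
Qed.

(** Splits off a leading term. The coefficient [n] may be zero: recursion on exponents only uses h <
    g. *)
Lemma lt_opow_divide x g : x < opow g -> x = ozero \/
  exists h n r, [/\ h < g, r < opow h & x = oadd (omul (opow h) (onat n)) r].
Proof.
move=> /lt_opow[|[h hg /lt_omul[_ /lt_omega[n ->]]]].
  by rewrite lt_osucc le_ozero => /eqP; left.
elim: n => [|n IH] /lt_oaddP[].
- by rewrite omulr0 lt_ozero.
- by move=> [r rh ->]; right; exists h, 0%N, r.
- by rewrite [onat _]/(osucc (onat n)) omulrS => /IH.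
- by move=> [r rh ->]; right; exists h, n.+1, r.
Qed.

(** * Existence and uniqueness of Cantor normal forms *)

Lemma cnf_nil p : cnf [::] p = ozero.
Proof. by rewrite /cnf big_nil. Qed.

Lemma cnf_cons a E p :
  cnf (a :: E) p = oadd (omul (opow a) (onat (p a))) (cnf E p).
Proof. by rewrite /cnf big_cons. Qed.

Lemma eq_in_cnf E p q : {in E, p =1 q} -> cnf E p = cnf E q.
Proof. by move=> pq; apply: eq_big_seq => x /pq->. Qed.

Lemma gt_path a (E : seq Ord) :
  path >%O a E = all (fun b => b < a) E && sorted >%O E.
Proof.
by rewrite path_sortedE // => x y z /= yx xz; apply: lt_trans yx.
Qed.

Lemma cnf_lt E p g :
  sorted >%O E -> all (fun b => b < g) E -> cnf E p < opow g.
Proof.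
elim: E g => [|a E IH] g /=; first by rewrite cnf_nil opow_gt0.
rewrite gt_path cnf_cons => /andP[Ea sE] /andP[ag _].
by apply: lt_opowM => //; apply: IH.
Qed.

Lemma cnf_surj g x : x < opow g ->
  exists E p, [/\ sorted >%O E, all (fun b => b < g) E & x = cnf E p].
Proof.
elim/Ord_ind: g x => g IH x /lt_opow_divide[->|[h [n [r [hg rh ->]]]]].
  by exists [::], (fun=> 0%N); rewrite cnf_nil.
have [E [p [sE Eh ->]]] := IH h hg r rh.
(* All exponents in [E] are below [h], so overriding [p] at [h] leaves the tail unchanged. *)
exists (h :: E), (fun b => if b == h then n else p b); split.
- by rewrite /= gt_path Eh.
- by rewrite /= hg; apply: sub_all Eh => b /lt_trans; apply.
rewrite cnf_cons eqxx; congr oadd; apply: eq_in_cnf => b /(allP Eh).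
by case: eqP => // ->; rewrite ltxx.
Qed.

(** Zero coefficients leave [E] undetermined by the ordinal; extension by zero outside [E] gives
    data that are determined. *)
Definition cnf_coef (E : seq Ord) (p : Ord -> nat) (b : Ord) : nat :=
  if b \in E then p b else 0.

Lemma opowM_lt h m n r s : r < opow h -> (m < n)%N ->
  oadd (omul (opow h) (onat m)) r < oadd (omul (opow h) (onat n)) s.
Proof.
move=> rh mn; apply: lt_le_trans (ole_addr _ _).
apply: (lt_le_trans (lt_oadd2l _ rh)).
by rewrite -omulrS omul_le // -[osucc _]/(onat m.+1) onat_le.
Qed.

Lemma opowM_inj h m n r s : r < opow h -> s < opow h ->
  oadd (omul (opow h) (onat m)) r = oadd (omul (opow h) (onat n)) s ->
  m = n /\ r = s.
Proof.
move=> rh sh e; case: (ltngtP m n) => [mn|nm|mn].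
- by have := opowM_lt s rh mn; rewrite e ltxx.
- by have := opowM_lt r sh nm; rewrite e ltxx.
by split=> //; move: e; rewrite mn => /oadd_inj.
Qed.

Lemma cnf_coef_cons a E p b : path >%O a E ->
  cnf_coef (a :: E) p b = if b == a then p a else cnf_coef E p b.
Proof. by rewrite /cnf_coef inE; case: eqP => // ->. Qed.

(** The right-hand form lies below omega^a, so it is omega^a * 0 plus itself, and division by
    omega^a is unique. *)
Lemma cnf_lead0 a E F p q : path >%O a E -> sorted >%O F ->
    all (fun b => b < a) F -> cnf (a :: E) p = cnf F q ->
  p a = 0%N /\ cnf E p = cnf F q.
Proof.
rewrite gt_path cnf_cons => /andP[Ea sE] sF Fa e.
apply: (@opowM_inj a); rewrite ?cnf_lt // e.
by rewrite [onat 0]/ozero omulr0 oadd0r.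
Qed.

(** Induction on the total length, removing the larger leading exponent. If the other list lacks it,
    its coefficient is zero; if both lists start with it, [opowM_inj] compares coefficients and
    tails. *)
Lemma cnf_inj E F p q : sorted >%O E -> sorted >%O F ->
  cnf E p = cnf F q -> cnf_coef E p =1 cnf_coef F q.
Proof.
have drop a E' F' p' q' : path >%O a E' -> sorted >%O F' ->
    all (fun b => b < a) F' -> cnf (a :: E') p' = cnf F' q' ->
    (cnf E' p' = cnf F' q' -> cnf_coef E' p' =1 cnf_coef F' q') ->
    cnf_coef (a :: E') p' =1 cnf_coef F' q'.
  move=> aE sF Fa /(cnf_lead0 aE sF Fa)[pa0 e] IH b.
  rewrite cnf_coef_cons // IH //; case: eqP => // ->.
  by rewrite pa0 /cnf_coef; case: ifP => // /(allP Fa); rewrite ltxx.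
have [n] := ubnP (size E + size F)%N; elim: n E F => // n IH [|a E] [|b F] //=.
- rewrite ltnS => sz _ bF e; apply: fsym; apply: drop => // {}e.
  by apply: fsym; apply: (IH [::] F) => //; apply: path_sorted bF.
- rewrite addn0 ltnS => sz aE _ e; apply: drop => // {}e.
  by apply: (IH E [::]); rewrite ?addn0 //; apply: path_sorted aE.
rewrite addSn ltnS addnS => sz aE bF e.
have [ab|ba|ab] := ltgtP a b.
- apply: fsym; apply: drop => //.
    rewrite /= ab; move: aE; rewrite gt_path => /andP[Ea _].
    by apply: sub_all Ea => c /lt_trans; apply.
  move=> {}e; apply: fsym; apply: (IH (a :: E) F) => //=.
  by apply: path_sorted bF.
- apply: drop => //.
    rewrite /= ba; move: bF; rewrite gt_path => /andP[Fb _].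
    by apply: sub_all Fb => c /lt_trans; apply.
  by move=> {}e; apply: (IH E (b :: F)) => //=; rewrite ?addnS // (path_sorted aE).
rewrite -ab in bF e *; move: (aE) (bF); rewrite !gt_path.
move=> /andP[Ea sE] /andP[Fa sF] x; rewrite !cnf_coef_cons //.
move: e; rewrite !cnf_cons => /opowM_inj[||-> e]; try exact: cnf_lt.
by case: eqP => // _; apply: IH => //; apply: ltn_trans sz.
Qed.

Lemma cnf_filter E p : cnf E p = cnf [seq b <- E | p b != 0%N] p.
Proof.
elim: E => //= a E IH; rewrite cnf_cons IH.
case: eqP => [->|_] /=; last by rewrite cnf_cons.
by rewrite omulr0 oadd0r.
Qed.

(** Once zero terms are dropped, both lists are strictly decreasing with the same members, hence
    equal. *)
Lemma eq_cnf E F p q : sorted >%O E -> sorted >%O F ->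
  cnf_coef E p =1 cnf_coef F q -> cnf E p = cnf F q.
Proof.
have suppE E' p' b :
    (b \in [seq b <- E' | p' b != 0%N]) = (cnf_coef E' p' b != 0%N).
  by rewrite mem_filter /cnf_coef; case: ifP; rewrite ?andbT ?andbF.
have gtT : transitive (>%O : rel Ord).
  by move=> y x z /= yx zy; apply: lt_trans yx.
move=> sE sF pq; rewrite cnf_filter [RHS]cnf_filter.
have -> : [seq b <- E | p b != 0%N] = [seq b <- F | q b != 0%N].
  apply: (irr_sorted_eq gtT); rewrite ?sorted_filter // => b /=.
    by rewrite ltxx.
  by rewrite !suppE pq.
apply: eq_in_cnf => b; rewrite mem_filter => /andP[qb bF].
move: (pq b) qb; rewrite /cnf_coef bF; case: ifP => // _ <-.
by rewrite eqxx.
Qed.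

(** * Coefficients as finitely supported functions *)

Definition descending (A : {fset Ord}) : seq Ord := rev (sort <=%O (A : seq Ord)).

Lemma descending_sorted A : sorted >%O (descending A).
Proof. by rewrite /descending rev_sorted sort_lt_sorted fset_uniq. Qed.

Lemma mem_descending A b : (b \in descending A) = (b \in A).
Proof. by rewrite mem_rev mem_sort. Qed.

Lemma gt_sorted_uniq (E : seq Ord) : sorted >%O E -> uniq E.
Proof. by rewrite -rev_sorted -rev_uniq; apply: lt_sorted_uniq. Qed.

Lemma cnfP x : exists E p, sorted >%O E /\ x = cnf E p.
Proof.
(* Every ordinal is below some power of omega, since x < x+1 <= omega^(x+1). *)
have /cnf_surj[E [p [sE _ xE]]] : x < opow (osucc x).
  by apply: (lt_le_trans _ (ole_opow _)); rewrite lt_osucc.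
by exists E, p.
Qed.

Lemma coef_exists x : exists f : {fsfun Ord -> nat with 0%N},
  forall E p, sorted >%O E -> x = cnf E p -> f =1 cnf_coef E p.
Proof.
have [E [p [sE xE]]] := cnfP x.
exists [fsfun b in seq_fset tt E => p b] => F q sF xF b.
rewrite fsfun_fun seq_fsetE -[LHS]/(cnf_coef E p b).
by apply: cnf_inj => //; rewrite -xE.
Qed.

(* The coefficients of the Cantor normal form of [x], indexed by exponents. *)
Definition coef (x : Ord) : {fsfun Ord -> nat with 0%N} :=
  projT1 (cid (coef_exists x)).

Lemma coef_cnf E p : sorted >%O E -> coef (cnf E p) =1 cnf_coef E p.
Proof. by move=> sE; apply: (projT2 (cid (coef_exists (cnf E p)))). Qed.

Lemma coef_inj x y : coef x =1 coef y -> x = y.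
Proof.
have [E [p [sE ->]]] := cnfP x; have [F [q [sF ->]]] := cnfP y.
by move=> xy; apply: eq_cnf => // b; rewrite -!coef_cnf.
Qed.

Lemma coef_descending (A : {fset Ord}) p b :
  coef (cnf (descending A) p) b = if b \in A then p b else 0%N.
Proof. by rewrite coef_cnf ?descending_sorted // /cnf_coef mem_descending. Qed.

(** Allowing any [A] that contains the support lets two ordinals be written over one list. *)
Lemma cnf_coef_id (A : {fset Ord}) x : (finsupp (coef x) `<=` A)%fset ->
  cnf (descending A) (coef x) = x.
Proof.
move=> /fsubsetP xA; apply: coef_inj => b; rewrite coef_descending.
by case: ifPn => // /(contra (xA b)); rewrite memNfinsupp => /eqP.
Qed.

Lemma lt_opow_coef x g : x < opow g <-> forall b, coef x b != 0%N -> b < g.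
Proof.
split=> [/cnf_surj[E [p [sE /allP Eg ->]]] b|xg].
  by rewrite coef_cnf // /cnf_coef; case: ifP => // /Eg.
rewrite -(@cnf_coef_id (finsupp (coef x)) x) ?fsubset_refl //; apply: cnf_lt; rewrite ?descending_sorted //.
by apply/allP => b; rewrite mem_descending mem_finsupp; apply: xg.
Qed.

Lemma coef_monomial a n b :
  coef (omul (opow a) (onat n)) b = if b == a then n else 0%N.
Proof.
have -> : omul (opow a) (onat n) = cnf [:: a] (fun=> n).
  by rewrite cnf_cons cnf_nil oaddr0.
by rewrite coef_cnf // /cnf_coef inE.
Qed.

Lemma coef_ozero b : coef ozero b = 0%N.
Proof. by rewrite -(cnf_nil (fun=> 0%N)) coef_cnf. Qed.

Lemma coef_onat1 b : coef (onat 1) b = (b == ozero).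
Proof.
have -> : onat 1 = omul (opow ozero) (onat 1).
  by rewrite opow0 [in RHS]/(onat 1) /= omulrS omulr0 oadd0r.
by rewrite coef_monomial; case: eqP.
Qed.

(** * The natural operations on coefficients *)

Lemma coef_is_hsum x y z :
  is_hsum x y z -> forall b, coef z b = (coef x b + coef y b)%N.
Proof.
move=> [E [p [q [sE -> -> ->]]]] b.
by rewrite !coef_cnf // /cnf_coef; case: ifP.
Qed.

Lemma hsumP x y : is_hsum x y (hsum x y).
Proof.
(* The union of the supports is the common list of exponents; the existence of a sum rules out the
   default of [xget]. *)
pose A := (finsupp (coef x) `|` finsupp (coef y))%fset.
suff : exists z, is_hsum x y z by move=> [z xyz]; apply: (xgetPex ozero); exists z.
exists (cnf (descending A) (fun b => coef x b + coef y b)%N).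
exists (descending A), (coef x), (coef y).
by rewrite descending_sorted !cnf_coef_id ?fsubsetUl ?fsubsetUr.
Qed.

Lemma coef_hsum x y b : coef (hsum x y) b = (coef x b + coef y b)%N.
Proof. exact/coef_is_hsum/hsumP. Qed.

Lemma coef_big_hsum (I : Type) (s : seq I) (F : I -> Ord) b :
  coef (\big[hsum/ozero]_(i <- s) F i) b = (\sum_(i <- s) coef (F i) b)%N.
Proof.
exact: (big_morph (fun x => coef x b) (fun x y => coef_hsum x y b) (coef_ozero b)).
Qed.

(** Terms with zero coefficient contribute nothing, so such a sum depends on the ordinal and not on
    the list presenting it. This makes the natural product independent of the chosen normal
    forms. *)
Lemma sum_cnf E p (G : Ord -> nat -> nat) : sorted >%O E ->
    (forall a, G a 0%N = 0%N) ->
  (\sum_(a <- E) G a (p a) =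
   \sum_(a <- finsupp (coef (cnf E p))) G a (coef (cnf E p) a))%N.
Proof.
move=> sE G0; set f := coef _.
have fE a : a \in E -> p a = f a by rewrite /f coef_cnf // /cnf_coef => ->.
rewrite (eq_big_seq (fun a => G a (f a))) => [|a /fE-> //].
rewrite -(@big_rmcond _ _ _ _ _ (fun a => f a != 0%N)) => [|a]; last first.
  by rewrite negbK => /eqP->.
rewrite -big_filter; apply: perm_big; apply: uniq_perm.
- exact/filter_uniq/gt_sorted_uniq.
- exact: fset_uniq.
move=> a; rewrite mem_filter mem_finsupp; case: eqP => //= /eqP.
by rewrite /f coef_cnf // /cnf_coef; case: (a \in E).
Qed.

Lemma coef_is_hprod x y z : is_hprod x y z -> forall c, coef z c =
  (\sum_(a <- finsupp (coef x)) \sum_(b <- finsupp (coef y) | hsum a b == c)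
     coef x a * coef y b)%N.
Proof.
move=> [E [F [p [q [sE sF -> -> ->]]]]] c; rewrite coef_big_hsum.
under eq_bigr => a _ do rewrite coef_big_hsum.
under eq_bigr => a _ do under eq_bigr => b _ do rewrite coef_monomial.
(* With the coefficient [n] as a variable, [sum_cnf] applies to the outer sum first and then to the
   inner one. *)
pose G a n := (\sum_(b <- F) if c == hsum a b then n * q b else 0)%N.
rewrite -[LHS]/(\sum_(a <- E) G a (p a))%N sum_cnf => [|//|a]; last first.
  by rewrite /G big1 // => b _; case: ifP.
apply: eq_bigr => a _; rewrite /G.
rewrite (@sum_cnf F q (fun b m => if c == hsum a b then coef (cnf E p) a * m else 0)%N)
  => [|//|b]; last by rewrite muln0; case: ifP.
by rewrite [RHS]big_mkcond; apply: eq_bigr => b _; rewrite eq_sym.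
Qed.

Lemma coef_hprod x y c : coef (hprod x y) c =
  (\sum_(a <- finsupp (coef x)) \sum_(b <- finsupp (coef y) | hsum a b == c)
     coef x a * coef y b)%N.
Proof.
apply: coef_is_hprod; apply: (xgetPex ozero).
pose E := descending (finsupp (coef x)); pose F := descending (finsupp (coef y)).
exists (\big[hsum/ozero]_(xi <- E) \big[hsum/ozero]_(eta <- F)
          omul (opow (hsum xi eta)) (onat (coef x xi * coef y eta))).
by exists E, F, (coef x), (coef y); rewrite !descending_sorted !cnf_coef_id.
Qed.

(** * Ordinals below a power of omega as finitely supported functions *)

(** Below omega^g all coefficients at exponents outside [g] vanish, so testing at the exponents
    named by [e] suffices. *)
Lemma opow_W_ext (J : Type) g (e : J -> W g) (x y : Ord) : bijective e ->
    x < opow g -> y < opow g ->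
  (forall j, coef x (sval (e j)) = coef y (sval (e j))) -> x = y.
Proof.
move=> [e' _ e'K] /lt_opow_coef xg /lt_opow_coef yg xy; apply: coef_inj => b.
have [bg|gb] := boolP (b < g).
  by have := xy (e' (exist _ b bg)); rewrite e'K.
have /eqP -> : coef x b == 0%N by apply: contraNT gb => /xg.
by apply/esym/eqP; apply: contraNT gb => /yg.
Qed.

(* Cantor normal forms with exponents below [g], where [e] names these exponents
   by elements of [J]. *)
Lemma digits (J : choiceType) g (e : J -> W g) : bijective e ->
  exists d : {fsfun J -> nat with 0%N} -> W (opow g),
    bijective d /\ forall p j, coef (sval (d p)) (sval (e j)) = p j.
Proof.
move=> be; have [e' eK e'K] := be.
pose F (p : {fsfun J -> nat with 0%N}) (b : Ord) : nat :=
  if insub b is Some w then p (e' w) else 0%N.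
pose A (p : {fsfun J -> nat with 0%N}) := [fset sval (e j) | j in finsupp p]%fset.
have dP p j : coef (cnf (descending (A p)) (F p)) (sval (e j)) = p j.
  rewrite coef_descending /F (valK (e j)) eK; case: ifPn => // jA.
  case: (finsuppP p j) => // jp; case/negP: jA; apply/imfsetP.
  by exists j.
have dlt p : cnf (descending (A p)) (F p) < opow g.
  apply/lt_opow_coef => b; rewrite coef_descending.
  by case: ifP => // /imfsetP[j _ ->] _; exact: (svalP (e j)).
pose d p : W (opow g) := exist (fun x : Ord => x < opow g) _ (dlt p).
exists d; split=> //.
(* The inverse reads off coefficients; its support is bounded by the names of the finitely many
   exponents of [x]. *)
pose d' (x : W (opow g)) : {fsfun J -> nat with 0%N} :=
  [fsfun j in seq_fset tt [seq e' w | w <- pmap insub (finsupp (coef (sval x)))]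
     => coef (sval x) (sval (e j))].
have d'E x j : d' x j = coef (sval x) (sval (e j)).
  rewrite fsfun_fun seq_fsetE; case: ifPn => // jx.
  case: (finsuppP (coef (sval x)) (sval (e j))) => // ex; case/negP: jx.
  by apply/mapP; exists (e j); rewrite ?eK // mem_pmap_sub.
exists d' => [p|x]; first by apply/fsfunP => j; rewrite d'E dP.
apply/val_inj; apply: (opow_W_ext be) => [||j]; [exact: (svalP (d (d' x)))|exact: (svalP x)|].
by rewrite dP d'E.
Qed.

(** * Transport of a semiring structure along a bijection *)

Section Transport.
Variables (T : choiceType) (S : comNzSemiRingType) (f : S -> T) (g : T -> S).
Hypotheses (fK : cancel f g) (gK : cancel g f).

(** A copy of [T] whose type mentions the cancellation proofs, so that the structure built from [f]
    and [g] can be attached to it. *)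
Definition transport of cancel f g & cancel g f : Type := T.
Notation U := (transport fK gK).
HB.instance Definition _ := Choice.on U.

Let zero : U := f 0%R.
Let one : U := f 1%R.
Let add (x y : U) : U := f (g x + g y)%R.
Let mul (x y : U) : U := f (g x * g y)%R.

Let addA : associative add.
Proof. by move=> x y z; rewrite /add !fK addrA. Qed.
Let addC : commutative add.
Proof. by move=> x y; rewrite /add addrC. Qed.
Let add0 : left_id zero add.
Proof. by move=> x; rewrite /add fK add0r gK. Qed.
Let mulA : associative mul.
Proof. by move=> x y z; rewrite /mul !fK mulrA. Qed.
Let mulC : commutative mul.
Proof. by move=> x y; rewrite /mul mulrC. Qed.
Let mul1 : left_id one mul.
Proof. by move=> x; rewrite /mul fK mul1r gK. Qed.
Let mulDl : left_distributive mul add.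
Proof. by move=> x y z; rewrite /mul /add !fK mulrDl. Qed.
Let mul0 : left_zero zero mul.
Proof. by move=> x; rewrite /mul fK mul0r. Qed.
Let one_neq0 : one != zero.
Proof. by apply/eqP => /(can_inj fK)/eqP; rewrite oner_eq0. Qed.

HB.instance Definition _ := GRing.isNmodule.Build U addA addC add0.
HB.instance Definition _ := GRing.Nmodule_isComNzSemiRing.Build U
  mulA mulC mul1 mulDl mul0 one_neq0.

Definition untransport (x : U) : S := g x.

Let untransport_add : nmod_morphism untransport.
Proof. by split=> [|x y]; apply: fK. Qed.
Let untransport_mul : monoid_morphism untransport.
Proof. by split=> [|x y]; apply: fK. Qed.

HB.instance Definition _ :=
  GRing.isNmodMorphism.Build U S untransport untransport_add.
HB.instance Definition _ :=
  GRing.isMonoidMorphism.Build U S untransport untransport_mul.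

End Transport.

(** * The isomorphism *)

(** Reindexes sums over exponents as sums over their names, to match the convolution in [natalg]. *)
Lemma finsupp_digits (J : choiceType) g (e : J -> W g) x
    (p : {fsfun J -> nat with 0%N}) : bijective e -> x < opow g ->
    (forall j, coef x (sval (e j)) = p j) ->
  perm_eq (finsupp (coef x)) [seq sval (e j) | j <- finsupp p].
Proof.
move=> be /lt_opow_coef xg xp; have [e' eK e'K] := be.
apply: uniq_perm; first exact: fset_uniq.
  rewrite map_inj_uniq ?fset_uniq // => i j ij.
  by apply: (bij_inj be); apply: val_inj.
move=> b; apply/idP/mapP => [|[j jp ->]]; last by rewrite mem_finsupp xp -mem_finsupp.
rewrite mem_finsupp => bx; pose w : W g := exist (fun x : Ord => x < g) b (xg b bx).
by exists (e' w); rewrite ?mem_finsupp -?xp e'K.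
Qed.

Lemma hsum_lt g x y : x < opow g -> y < opow g -> hsum x y < opow g.
Proof.
move=> /lt_opow_coef xg /lt_opow_coef yg; apply/lt_opow_coef => b.
by rewrite coef_hsum addn_eq0 negb_and => /orP[/xg|/yg].
Qed.

(** Exponents of the product are natural sums of exponents below omega^g, and [hsum_lt] keeps these
    below omega^g. Here the double power enters. *)
Lemma hprod_lt g x y :
  x < opow (opow g) -> y < opow (opow g) -> hprod x y < opow (opow g).
Proof.
move=> /lt_opow_coef xg /lt_opow_coef yg; apply/lt_opow_coef => c.
rewrite coef_hprod; apply: contraNT => cg; apply/eqP.
rewrite big_seq big1 // => a; rewrite mem_finsupp => /xg ag.
rewrite big_seq_cond big1 // => b /andP[]; rewrite mem_finsupp => /yg bg /eqP ab.
by case/negP: cg; rewrite -ab hsum_lt.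
Qed.

(** A monomial is a finitely supported function on [W alpha], so [digits] applies with each exponent
    naming itself. *)
Lemma cmonom_ordinals (alpha : Ord) : exists e : {cmonom W alpha} -> W (opow alpha),
  [/\ bijective e, sval (e mone) = ozero &
      forall k l, sval (e (mmul k l)) = hsum (sval (e k)) (sval (e l))].
Proof.
have bid : bijective (id : W alpha -> W alpha) by exists id.
have [d [[d' dK d'K] dE]] := digits bid.
have lt_d p : sval (d p) < opow alpha by exact: (svalP (d p)).
exists (fun k => d (cmonom_val k)); split=> [||k l].
- exists (fun w => mkcmonom (d' w)) => [k|w].
    by apply: val_inj; rewrite /= dK [mkcmonom]unlock.
  by rewrite [mkcmonom]unlock /= d'K.
- apply: (opow_W_ext bid); rewrite ?opow_gt0 // => j.
  by rewrite dE coef_ozero cm1.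
apply: (opow_W_ext bid); rewrite ?hsum_lt // => j.
by rewrite coef_hsum !dE cmM.
Qed.

Theorem proposition7 (alpha : Ord) :
  exists c : GRing.ComNzSemiRing.axioms_ (W (opow (opow alpha))),
    hessenberg_semiring c /\
    exists f : {rmorphism (GRing.ComNzSemiRing.Pack c : comNzSemiRingType)
                       -> natalg {cmonom W alpha}},
      bijective f.
Proof.
have [e [be e1 eM]] := cmonom_ordinals alpha.
(* Second use of [digits]: the exponents, now below omega^alpha, are named by monomials. *)
have [d [[d' dK d'K] dE]] := digits be.
have lt_d p : sval (d p) < opow (opow alpha) by exact: (svalP (d p)).
pose f (p : natalg {cmonom W alpha}) : W (opow (opow alpha)) := d p.
pose g (x : W (opow (opow alpha))) : natalg {cmonom W alpha} := d' x.
have fK : cancel f g by exact: dK.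
have gK : cancel g f by exact: d'K.
(* The semiring laws and the isomorphism come from transport; it remains to identify the transported
   operations with the Hessenberg ones. *)
pose R : comNzSemiRingType := transport fK gK.
exists (GRing.ComNzSemiRing.class R); split; last first.
  by exists (untransport (fK := fK) (gK := gK)); exists f.
have fD p q : sval (f (naadd p q)) = hsum (sval (f p)) (sval (f q)).
  apply: (opow_W_ext be); rewrite ?hsum_lt // => j.
  by rewrite coef_hsum !dE naaddE.
have fM p q : sval (f (namul p q)) = hprod (sval (f p)) (sval (f q)).
  apply: (opow_W_ext be); rewrite ?hprod_lt // => j.
  rewrite coef_hprod !dE namulE.
  rewrite (perm_big _ (finsupp_digits be (lt_d p) (dE p))) big_map.
  apply: eq_bigr => k1 _.
  rewrite (perm_big _ (finsupp_digits be (lt_d q) (dE q))) big_map.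
  apply: eq_big => [k2|k2 _]; last by rewrite !dE.
  (* Since [e] turns products of monomials into natural sums, both convolutions select the same
     pairs. *)
  by rewrite -eM (inj_eq val_inj) (bij_eq be).
split.
- apply: (opow_W_ext be) => [||j]; rewrite ?opow_gt0 //; first exact: lt_d.
  by rewrite dE coef_ozero na0E.
- apply: (opow_W_ext be) => [||j]; first exact: lt_d.
    (* The unit is omega^0, and 0 < omega^alpha. *)
    rewrite -opow0; apply/opow_lt/opow_gt0.
  by rewrite dE coef_onat1 na1E -e1 (inj_eq val_inj) (bij_eq be).
- by move=> x y; rewrite [LHS]fD !gK.
- by move=> x y; rewrite [LHS]fM !gK.
Qed.
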